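(* Let $\Omega\subset\mathbb{R}^3$ be a compact domain with Lipschitz boundary, consisting of a homogeneous isotropic linear elastic material. Let $\epsilon$ and $\epsilon'$ be symmetric rank-2 tensor fields of class $C^2$ on $\Omega$ (elastic strain fields) whose corresponding stresses $\sigma=C:\epsilon$ and $\sigma'=C:\epsilon'$ satisfy $\mathrm{Div}(\sigma)=\mathrm{Div}(\sigma')=0$ on $\Omega$ and $\sigma\cdot n=\sigma'\cdot n=0$ on $\partial\Omega$. If the three shear components agree, i.e. $\epsilon_{12}=\epsilon'_{12}$, $\epsilon_{13}=\epsilon'_{13}$ and $\epsilon_{23}=\epsilon'_{23}$ on $\Omega$, then $\epsilon=\epsilon'$ on $\Omega$. That is, the three shear components of strain uniquely determine the whole strain tensor.
   Context: A compact domain is the closure of a nonempty bounded connected open set. Here $n$ is the outward unit normal on $\partial\Omega$ (defined almost everywhere), $[\mathrm{Div}(\sigma)]_j=\sum_i\partial_i\sigma_{ij}$ and $[\sigma\cdot n]_i=\sum_j\sigma_{ij}n_j$. $C$ is the constant positive definite isotropic elasticity tensor with Young's modulus $E>0$ and Poisson's ratio $-1<\nu<1/2$; Hooke's law $\sigma=C:\epsilon$ is equivalent to $\epsilon_{ij}=\frac{1}{E}\big((1+\nu)\sigma_{ij}-\nu\,\mathrm{tr}(\sigma)\,\delta_{ij}\big)$. *)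

(* Defs.v *)
From mathcomp Require Import all_boot all_order all_algebra.
From mathcomp Require Import all_classical all_reals all_analysis.
From mathcomp Require Import ring lra.

Set Implicit Arguments.
Unset Strict Implicit.
Unset Printing Implicit Defensive.

Import Order.TTheory GRing.Theory Num.Theory.
Import numFieldNormedType.Exports.

Local Open Scope classical_set_scope.
Local Open Scope ring_scope.

(* Points and vectors of R^3 are row vectors 'rV[R]_3.  The library norm on   *)
(* 'rV[R]_3 is the sup norm: only notions that do not distinguish it from the *)
(* Euclidean norm (topology, boundedness, Lipschitz maps, null sets) are      *)
(* taken with respect to it; orthogonality and unit length are spelled out.   *)

Definition basis_vec (R : realType) (n : nat) (i : 'I_n) : 'rV[R]_n :=
  delta_mx 0 i.

Definition frontier (R : realType) (A : set 'rV[R]_3) : set 'rV[R]_3 :=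
  closure A `\` interior A.

Definition compact_domain (R : realType) (Omega : set 'rV[R]_3) : Prop :=
  exists U : set 'rV[R]_3,
    [/\ U !=set0, bounded_set U, connected U, open U & Omega = closure U].

(* In the orthonormal frame given by the columns of Q, the coordinates of z   *)
(* are z *m Q : 'rV_(2 + 1); the first two are horizontal, the last vertical. *)
Definition horizontal (R : realType) (Q : 'M[R]_3) (z : 'rV[R]_3) : 'rV[R]_2 :=
  lsubmx (z *m Q : 'rV[R]_(2 + 1)).

Definition vertical (R : realType) (Q : 'M[R]_3) (z : 'rV[R]_3) : R :=
  (z *m Q) 0 ord_max.

(* Near x, the set Omega is the subgraph of the Lipschitz function g. *)
Definition lipschitz_chart (R : realType) (Omega : set 'rV[R]_3)
    (x : 'rV[R]_3) (Q : 'M[R]_3) (g : 'rV[R]_2 -> R^o) : Prop :=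
  [/\ Q *m Q^T = 1%:M,
      lipschitz g
    & \forall z \near x, Omega z <-> vertical Q z <= g (horizontal Q z)].

Definition lipschitz_boundary (R : realType) (Omega : set 'rV[R]_3) : Prop :=
  forall x, frontier Omega x -> exists Q g, lipschitz_chart Omega x Q g.

Definition gradient (R : realType) (g : 'rV[R]_2 -> R^o) (y : 'rV[R]_2) :
    'rV[R]_2 :=
  \row_j 'D_(basis_vec R j) g y.

(* The upward unit normal (- grad g, 1) / sqrt (1 + |grad g|^2) to the graph  *)
(* of g, in the coordinates of the chart.                                     *)
Definition graph_normal (R : realType) (g : 'rV[R]_2 -> R^o) (y : 'rV[R]_2) :
    'rV[R]_3 :=
  (Num.sqrt (1 + \sum_j gradient g y 0 j ^+ 2))^-1 *:
    (row_mx (- gradient g y) (1%:M : 'rV[R]_1) : 'rV[R]_(2 + 1)).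

(* As Q is orthogonal, Q^T maps chart coordinates back to the standard ones.  *)
(* Omega lies below the graph, so the upward normal is the outward one.       *)
Definition outward_unit_normal (R : realType) (Omega : set 'rV[R]_3)
    (x n : 'rV[R]_3) : Prop :=
  frontier Omega x /\
  exists (Q : 'M[R]_3) (g : 'rV[R]_2 -> R^o),
    [/\ lipschitz_chart Omega x Q g,
        differentiable g (horizontal Q x)
      & n = graph_normal g (horizontal Q x) *m Q^T].

(* Sets of zero two-dimensional Hausdorff measure; on a Lipschitz surface     *)
(* these are exactly the sets of zero surface area.                           *)
Definition surface_null (R : realType) (N : set 'rV[R]_3) : Prop :=
  forall e : R, 0 < e ->
    exists (c : nat -> 'rV[R]_3) (r : nat -> R),
      N `<=` \bigcup_k ball (c k) (r k) /\
      (\sum_(0 <= k <oo) (r k ^+ 2)%:E <= e%:E)%E.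

Definition ae_on_frontier (R : realType) (Omega : set 'rV[R]_3)
    (P : 'rV[R]_3 -> Prop) : Prop :=
  surface_null (frontier Omega `&` [set x | ~ P x]).

(* By Rademacher's theorem the outward unit normal of a set with Lipschitz    *)
(* boundary exists almost everywhere; n is that normal, with arbitrary values *)
(* on the exceptional null set.                                               *)
Definition outward_normal_field (R : realType) (Omega : set 'rV[R]_3)
    (n : 'rV[R]_3 -> 'rV[R]_3) : Prop :=
  ae_on_frontier Omega (fun x => outward_unit_normal Omega x (n x)).

(* C^k up to the boundary: the partial derivatives of order <= k exist in the *)
(* interior of Omega and extend continuously to Omega.                        *)
Fixpoint Ck_on (R : realType) (k : nat) (Omega : set 'rV[R]_3)
    (f : 'rV[R]_3 -> R^o) : Prop :=
  {within Omega, continuous f} /\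
  if k is k'.+1 then
    forall i : 'I_3, exists df : 'rV[R]_3 -> R^o,
      Ck_on k' Omega df /\
      forall x, interior Omega x -> is_derive x (basis_vec R i) f (df x)
  else True.

Definition C2_sym_tensor_field (R : realType) (Omega : set 'rV[R]_3)
    (T : 'rV[R]_3 -> 'M[R]_3) : Prop :=
  (forall i j : 'I_3, Ck_on 2 Omega (fun x => T x i j)) /\
  (forall x, Omega x -> (T x)^T = T x).

(* Lame's form of the isotropic elasticity tensor:                            *)
(* C_ijkl = lambda d_ij d_kl + mu (d_ik d_jl + d_il d_jk).                    *)
Definition elasticity_tensor (R : realType) (E nu : R) (i j k l : 'I_3) : R :=
  let lambda := E * nu / ((1 + nu) * (1 - 2 * nu)) in
  let mu := E / (2 * (1 + nu)) in
  lambda * (i == j)%:R * (k == l)%:R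
  + mu * ((i == k)%:R * (j == l)%:R + (i == l)%:R * (j == k)%:R).

Definition stress (R : realType) (E nu : R) (eps : 'rV[R]_3 -> 'M[R]_3) :
    'rV[R]_3 -> 'M[R]_3 :=
  fun x => \matrix_(i, j) \sum_k \sum_l elasticity_tensor E nu i j k l * eps x k l.

Definition Div (R : realType) (T : 'rV[R]_3 -> 'M[R]_3) (x : 'rV[R]_3) :
    'rV[R]_3 :=
  \row_j \sum_i 'D_(basis_vec R i) (fun y => T y i j : R^o) x.

(* Where T is C^1 up to the boundary, Div T extends continuously to Omega, so *)
(* vanishing in the interior amounts to vanishing on Omega.                   *)
Definition divergence_free (R : realType) (Omega : set 'rV[R]_3)
    (T : 'rV[R]_3 -> 'M[R]_3) : Prop :=
  forall x, interior Omega x -> Div T x = 0.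

Definition traction_free (R : realType) (Omega : set 'rV[R]_3)
    (n : 'rV[R]_3 -> 'rV[R]_3) (T : 'rV[R]_3 -> 'M[R]_3) : Prop :=
  ae_on_frontier Omega (fun x => T x *m (n x)^T = 0).

(* Hooke's law in compliance form. *)
Lemma hooke_inverse (R : realType) (E nu : R) (eps : 'rV[R]_3 -> 'M[R]_3)
    (x : 'rV[R]_3) (i j : 'I_3) :
  0 < E -> -1 < nu < 1 / 2 -> (eps x)^T = eps x ->
  eps x i j = E^-1 * ((1 + nu) * stress E nu eps x i j
                      - nu * \tr (stress E nu eps x) * (i == j)%:R).
Proof.
move=> E0 /andP[nu1 nu2] sym.
have S a b : eps x a b = eps x b a by rewrite -[in LHS]sym mxE.
have h1 : E != 0 by apply: lt0r_neq0.
have h2 : 1 + nu != 0 by apply: lt0r_neq0; lra.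
have h3 : 1 - 2 * nu != 0 by apply: lt0r_neq0; lra.
pose lambda := E * nu / ((1 + nu) * (1 - 2 * nu)).
pose mu := E / (2 * (1 + nu)).
have st a b : stress E nu eps x a b =
    lambda * (a == b)%:R * \tr (eps x) + 2 * mu * eps x a b.
  rewrite mxE /elasticity_tensor -/lambda -/mu.
  transitivity (\sum_k (lambda * (a == b)%:R * eps x k k
      + mu * ((a == k)%:R * eps x k b + (b == k)%:R * eps x a k))).
    apply: eq_bigr => k _.
    under eq_bigr do rewrite mulrDl.
    rewrite big_split /=; congr (_ + _).
      rewrite (bigD1 k) //= big1 ?addr0; last first.
        by move=> l /negbTE; rewrite eq_sym => ->; rewrite mulr0 mul0r.
      by rewrite eqxx mulr1.
    under eq_bigr do rewrite -mulrA mulrDl.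
    rewrite -mulr_sumr big_split /=; congr (_ * (_ + _)).
      rewrite (bigD1 b) //= big1 ?addr0 ?eqxx ?mulr1 //.
      by move=> l /negbTE; rewrite eq_sym => ->; rewrite mulr0 mul0r.
    rewrite (bigD1 a) //= big1 ?addr0 ?eqxx ?mul1r 1?S //.
    by move=> l /negbTE; rewrite eq_sym => ->; rewrite !mul0r.
  rewrite big_split /= -mulr_sumr; congr (_ + _).
  rewrite -mulr_sumr big_split /=.
  rewrite (bigD1 a) //= big1 ?addr0 ?eqxx ?mul1r; last first.
    by move=> k /negbTE; rewrite eq_sym => ->; rewrite mul0r.
  rewrite (bigD1 b) //= big1 ?addr0 ?eqxx ?mul1r; last first.
    by move=> k /negbTE; rewrite eq_sym => ->; rewrite mul0r.
  by ring.
have tr : \tr (stress E nu eps x) = (3 * lambda + 2 * mu) * \tr (eps x).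
  rewrite [LHS]/mxtrace; under eq_bigr do rewrite st eqxx mulr1.
  by rewrite big_split /= sumr_const card_ord -mulr_sumr -/(\tr _); ring.
by rewrite tr st /lambda /mu; field; rewrite h1 h2 h3.
Qed.

(* Main.v *)
Require Import Defs.
From mathcomp Require Import all_boot all_order all_algebra.
From mathcomp Require Import all_classical all_reals all_analysis.
From mathcomp Require Import measurable_realfun.
From mathcomp Require Import ring lra.

Set Implicit Arguments.
Unset Strict Implicit.
Unset Printing Implicit Defensive.

Import Order.TTheory GRing.Theory Num.Theory.
Import numFieldNormedType.Exports.

Local Open Scope classical_set_scope.
Local Open Scope ring_scope.

(** Let T be the difference of the two stresses.  By Hooke's law the shear
    strains and the shear stresses determine each other, so T is diagonal on
    Omega.  The equilibrium equations then decouple: the i-th one says that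
    T_ii is constant along segments parallel to e_i in the interior.  Likewise
    the i-th traction condition becomes T_ii n_i = 0 almost everywhere on the
    boundary.

    Suppose T_ii x <> 0 at an interior point x.  Follow the line from x in the
    direction e_i up to the first point p of the boundary ([exit_point]); by
    continuity T_ii does not vanish near p, so e_i is tangent to the boundary
    at almost every boundary point near p.  In a chart at p, where the boundary
    is the graph of a Lipschitz function g, let (a, b) be the coordinates of
    e_i and (h, g h) those of p.  Tangency at a boundary point says that the derivative of g in the
    direction a is b at the point below it ([tangent_flat]).  As g is Lipschitz
    and this holds almost everywhere, Fubini's theorem
    ([negligible_xsections]) and the fact that a Lipschitz function of one real
    variable with zero derivative almost everywhere is constant
    ([lipschitz_ae_flat_cst]) give g (h + t a) = g h + t b: near p, the line
    through p parallel to e_i lies in the boundary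
    ([frontier_contains_segment]).  But the points of that line just before p
    are interior, a contradiction ([transported_component_eq0]).

    So T = 0 in the interior, hence on Omega by continuity, and the compliance
    form of Hooke's law gives the equality of the strains.

    The normal is only given almost everywhere, and each normal comes with a
    chart of its own.  Tangency is therefore expressed without charts, by
    [tangent_direction]. *)

(** * Lipschitz functions of one variable *)

(** The derivative of u at t exists and is zero. *)
Definition flat (R : realType) (u : R -> R) (t : R) : Prop :=
  forall e : R, 0 < e ->
    \forall s \near (0 : R), `|u (t + s) - u t| <= e * `|s|.

Lemma negligible_open_cover (R : realType) (N : set R) (e : R) :
  0 < e -> lebesgue_measure.-negligible N ->
  exists U : set R, [/\ open U, N `<=` U & (lebesgue_measure U < e%:E)%E].
Proof.
move=> e0 [B [mB B0 NB]].
have Boo : ((@lebesgue_measure R) B < +oo)%E by rewrite [ltLHS]B0 ltry.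
have [U [oU BU UBe]] := lebesgue_regularity_outer mB Boo e0.
exists U; split => //; first exact: subset_trans BU.
have mU : measurable (U : set (measurableTypeR R)) by exact: open_measurable.
rewrite -(setDKU BU) measureU //=; first by rewrite [X in (_ + X)%E]B0 adde0.
- exact: measurableD.
- by rewrite setDE -setIA setICl setI0.
Qed.

(** Continuous induction.  Cover N by an open set U of measure less than e, let
    m t be the measure of the part of U between a and t, and take the last t at which
    |u t - u a| <= e (t - a) + L m t.  If t < b, the estimate still holds a
    little further: inside U because u grows at most at the rate L while m
    grows at the rate 1, outside U because u is flat at t. *)
Lemma lipschitz_ae_flat_cst (R : realType) (u : R -> R) (L a b : R)
    (N : set R) :
  0 <= L -> (forall x y, `|u x - u y| <= L * `|x - y|) -> a <= b ->
  lebesgue_measure.-negligible N ->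
  (forall t, a <= t < b -> ~ N t -> flat u t) -> u b = u a.
Proof.
move=> L0 uL ab N0 uflat.
suff H e : 0 < e -> `|u b - u a| <= e * (b - a + L).
  apply/eqP; rewrite -subr_eq0 -normr_le0; apply/ler_addgt0Pr => e e0.
  have bL0 : 0 < b - a + L + 1 by lra.
  rewrite add0r (le_trans (H (e / (b - a + L + 1)) _)) ?divr_gt0//.
  rewrite mulrAC ler_pdivrMr// ler_wpM2l//; lra.
move=> e0.
have [U [oU NU Ue]] := negligible_open_cover e0 N0.
have mU : measurable (U : set (measurableTypeR R)) by exact: open_measurable.
pose mu := @lebesgue_measure R.
have mV t : measurable (U `&` `]a, t]%classic : set (measurableTypeR R)).
  by apply: measurableI => //; exact: measurable_itv.
have muV t : (mu (U `&` `]a, t]%classic) < e%:E)%E.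
  by apply: le_lt_trans Ue; apply: le_measure; rewrite ?inE//.
have finV t : mu (U `&` `]a, t]%classic) \is a fin_num.
  rewrite ge0_fin_numE ?measure_ge0//; exact: lt_trans (muV t) (ltry _).
pose m t := fine (mu (U `&` `]a, t]%classic)).
have m_lt t : m t < e by rewrite -lte_fin fineK.
have m_ge0 t : 0 <= m t by rewrite fine_ge0// measure_ge0.
have m_mono x y : x <= y -> m x <= m y.
  move=> xy; rewrite -lee_fin !fineK//; apply: le_measure; rewrite ?inE//.
  apply: setIS => z /=; rewrite !in_itv/= => /andP[-> zx]; exact: le_trans xy.
have m_incr c d : a <= c -> c <= d -> `[c, d]%classic `<=` U ->
    m c + (d - c) <= m d.
  move=> ac cd cdU.
  rewrite -lee_fin EFinD !fineK//.
  have <- : mu `]c, d]%classic = (d - c)%:E.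
    rewrite /mu lebesgue_measure_itv /= lte_fin; case: ltP => // dc.
    by rewrite (le_anti (introT andP (conj dc cd))) subrr.
  rewrite -measureU//=.
    apply: le_measure; rewrite ?inE//; first exact: measurableU.
    move=> z [[Uz]|] /=; rewrite !in_itv/= => /andP[z1 z2].
      by split => //=; rewrite z1 (le_trans z2).
    split; last by rewrite z2 (le_lt_trans ac).
    by apply: cdU; rewrite /= in_itv/= z2 ltW.
  rewrite -subset0 => z [[_]] /=; rewrite !in_itv/= => /andP[_ zc] /andP[cz _].
  by rewrite ltNge zc in cz.
pose S := [set t | a <= t <= b /\ `|u t - u a| <= e * (t - a) + L * m t].
have Sa : S a.
  by split; rewrite ?lexx// !subrr normr0 mulr0 add0r mulr_ge0.
have supS : has_sup S by split; [exists a|exists b => t [/andP[]]].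
pose c := sup S.
have ac : a <= c by apply: ub_le_sup => //; case: supS.
have cb : c <= b by apply: ge_sup; [exists a|move=> t [/andP[]]].
have Sc : S c.
  split; first by rewrite ac cb.
  apply/ler_addgt0Pr => d d0.
  have L1 : 0 < L + 1 by lra.
  have [t St ct] := sup_adherent (divr_gt0 d0 L1) supS.
  have tc : t <= c by apply: ub_le_sup => //; case: supS.
  rewrite -(subrKA (u t)) (le_trans (ler_normD _ _))// addrC lerD//.
    case: St => _ /le_trans; apply; rewrite lerD//; last by rewrite ler_wpM2l// m_mono.
    by rewrite ler_wpM2l ?(ltW e0)// lerB.
  rewrite (le_trans (uL _ _))//.
  have -> : `|c - t| = c - t by rewrite ger0_norm// subr_ge0.
  have h : c - t <= d / (L + 1) by rewrite -/c in ct; lra.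
  rewrite (le_trans (ler_wpM2l L0 h))// mulrA ler_pdivrMr//; nra.
(* As c is the maximum of S, the estimate cannot persist from c to a later d. *)
have step d : c < d <= b -> `|u d - u c| <= e * (d - c) + L * (m d - m c) -> False.
  move=> /andP[cd db] H.
  have Sd : S d.
    split; first by rewrite db (le_trans ac)// ltW.
    rewrite -(subrKA (u c)) (le_trans (ler_normD _ _))//.
    by case: Sc => _ Sc; lra.
  have : d <= c by apply: ub_le_sup => //; case: supS.
  by rewrite leNgt cd.
have [cltb|bc] := ltP c b; last first.
  have cE : c = b by apply/eqP; rewrite eq_le cb bc.
  case: Sc => _; rewrite cE => /le_trans; apply; rewrite [leRHS]mulrDr lerD2l [leLHS]mulrC.
  by rewrite ler_wpM2r// ltW.
have near_step (P : R -> Prop) : (\forall s \near (0 : R), P s) ->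
    exists d, c < d <= b /\ forall s, 0 <= s <= d - c -> P s.
  move=> /nbhs_ballP[r /= r0 rP].
  exists (Num.min b (c + r / 2)); split.
    by rewrite ge_min lexx lt_min cltb ltrDl divr_gt0.
  move=> s /andP[s0 sr]; apply: rP; rewrite /ball /= sub0r normrN ger0_norm//.
  have := ge_min (c + r / 2) b (c + r / 2); rewrite lexx orbT => h.
  by lra.
have [cU|cU] := pselect (U c).
  have : \forall s \near (0 : R), U (c + s).
    have /nbhs_ballP[r /= r0 rU] : nbhs c U by exact: open_nbhs_nbhs.
    apply/nbhs_ballP; exists r => //= s; rewrite /ball /= sub0r normrN => sr.
    by apply: rU; rewrite /ball/= opprD addrA subrr sub0r normrN.
  move=> /near_step[d [/andP[cd db] dU]].
  exfalso; apply: (step d); first by rewrite cd db.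
  rewrite (le_trans (uL _ _))//.
  have -> : `|d - c| = d - c by rewrite ger0_norm// subr_ge0 ltW.
  have := m_incr c d ac (ltW cd); move=> H.
  have {}H : m c + (d - c) <= m d.
    apply: H => z /=; rewrite in_itv/= => /andP[cz zd].
    by rewrite -(subrKC c z); apply: dU; rewrite subr_ge0 cz lerD2r.
  have : L * (d - c) <= L * (m d - m c) by rewrite ler_wpM2l//; lra.
  have : 0 <= e * (d - c) by rewrite mulr_ge0 ?(ltW e0)// subr_ge0 ltW.
  lra.
have /(_ e e0) : flat u c.
  by apply: uflat; [rewrite ac cltb|move=> /NU].
move=> /near_step[d [/andP[cd db] dU]].
exfalso; apply: (step d); first by rewrite cd db.
have := dU (d - c); rewrite subrKC => {}dU.
have {}dU : `|u d - u c| <= e * `|d - c|.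
  by apply: dU; rewrite lexx subr_ge0 ltW.
have E : `|d - c| = d - c by rewrite ger0_norm// subr_ge0 ltW.
rewrite E in dU; apply: (le_trans dU); rewrite lerDl mulr_ge0// subr_ge0.
by apply: m_mono; exact: ltW.
Qed.

(** * Null sets of the plane *)

(** A square of half-side r has area 4 r^2, so the squares have arbitrarily
    small total area. *)
Lemma square_cover_negligible (R : realType) (M : set (R * R)) :
  (forall e : R, 0 < e -> exists (c : nat -> R * R) (r : nat -> R),
    M `<=` \bigcup_k [set p | `|p.1 - (c k).1| <= r k /\
                              `|p.2 - (c k).2| <= r k] /\
    (\sum_(0 <= k <oo) (r k ^+ 2)%:E <= e%:E)%E) ->
  (@lebesgue_measure R \x @lebesgue_measure R)%E.-negligible M.
Proof.
move=> cover.
pose mu2 := (@lebesgue_measure R \x @lebesgue_measure R)%E.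
pose sq (c : R * R) (r : R) : set (measurableTypeR R * measurableTypeR R) :=
  `[c.1 - r, c.1 + r]%classic `*` `[c.2 - r, c.2 + r]%classic.
have msq c r : measurable (sq c r) by apply: measurableX; exact: measurable_itv.
have sqE c r : (mu2 (sq c r) <= (4 * r ^+ 2)%:E)%E.
  rewrite /mu2 /sq product_measure1E; do ?exact: measurable_itv.
  rewrite /= !lebesgue_measure_itv /= !lte_fin.
  have [r0|r0] := ltP 0 r.
    rewrite !ifT; [|lra..].
    by rewrite -!EFinB -EFinM lee_fin; nra.
  rewrite !ifF; [|apply/negbTE; rewrite -leNgt; lra..].
  by rewrite mule0 lee_fin mulr_ge0// sqr_ge0.
have /choice[A mAM] : forall m : nat,
    exists X : set (measurableTypeR R * measurableTypeR R),
      [/\ measurable X, M `<=` X & (mu2 X <= m.+1%:R^-1%:E)%E].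
  move=> m.
  have e0 : 0 < (4 * m.+1%:R)^-1 :> R by rewrite invr_gt0 mulr_gt0// ltr0n.
  have [c [r [Mcr cr]]] := cover _ e0.
  exists (\bigcup_k sq (c k) (r k)); split.
  - exact: bigcupT_measurable.
  - move=> p /Mcr[k _ /= [p1 p2]]; exists k => //; split => /=.
      by rewrite in_itv/= -ler_distl.
    by rewrite in_itv/= -ler_distl.
  - apply: (@le_trans _ _ (\sum_(0 <= k <oo) mu2 (sq (c k) (r k)))%E).
      apply: measure_sigma_subadditive => //.
      exact: bigcupT_measurable.
    apply: (@le_trans _ _ (\sum_(0 <= k <oo) (4%:E * (r k ^+ 2)%:E))%E).
      by apply: lee_nneseries => // k _; exact: sqE.
    rewrite nneseriesZl//; last by move=> k _; rewrite lee_fin sqr_ge0.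
    rewrite (le_trans (lee_wpmul2l _ cr))// -EFinM lee_fin invfM mulrA.
    by rewrite divff// mul1r.
exists (\bigcap_m A m); split.
- by apply: bigcapT_measurable => m; have [] := mAM m.
- apply/eqP; rewrite -measure_le0; apply/lee_addgt0Pr => e e0; rewrite add0e.
  have [m me] : exists m : nat, m.+1%:R^-1 < e.
    by have [m _ /(_ m (leqnn _))] := near_infty_natSinv_lt (PosNum e0); exists m.
  have [mA _ Am] := mAM m.
  apply: (@le_trans _ _ (mu2 (A m))); last first.
    by rewrite (le_trans Am)// lee_fin ltW.
  apply: le_measure; rewrite ?inE//; last exact: bigcap_inf.
  by apply: bigcapT_measurable => k; have [] := mAM k.
- by move=> p Mp m _; have [_ + _] := mAM m; exact.
Qed.

Lemma negligible_xsections (R : realType) (M : set (R * R)) :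
  (@lebesgue_measure R \x @lebesgue_measure R)%E.-negligible M ->
  (@lebesgue_measure R).-negligible
    [set s | ~ (@lebesgue_measure R).-negligible [set t | M (s, t)]].
Proof.
move=> [B [mB B0 MB]].
have mf := measurable_fun_xsection (@lebesgue_measure R) mB.
have /(ae_eq_integral_abs _ measurableT mf) :
    (\int[lebesgue_measure]_x `|(lebesgue_measure \o xsection B) x| = 0)%E.
  rewrite -[RHS]B0 /product_measure1; apply: eq_integral => x _.
  by rewrite gee0_abs.
apply: negligibleS => s; apply: contra_not => /(_ I) Bs0.
exists (xsection B s); split => //; first exact: measurable_xsection.
by move=> t Mst; rewrite /xsection /= inE; exact: MB.
Qed.

(** * Chart coordinates *)

Lemma coord_norm_le (R : realType) (m n : nat) (A : 'M[R]_(m, n)) i j :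
  `|A i j| <= `|A|.
Proof.
rewrite [leRHS]/Num.norm /= mx_normrE.
exact: (le_bigmax _ (fun ij => `|A ij.1 ij.2|) (i, j)).
Qed.

Lemma norm_le_coord (R : realType) (m n : nat) (A : 'M[R]_(m, n)) (c : R) :
  0 <= c -> (forall i j, `|A i j| <= c) -> `|A| <= c.
Proof.
move=> c0 Ac; rewrite [leLHS]/Num.norm /= mx_normrE.
by apply/bigmax_leP; split => // -[i j] _; exact: Ac.
Qed.

Lemma norm_mulmx_le (R : realType) (m n : nat) (A : 'M[R]_(m, n)) :
  exists2 K : R, 0 < K & forall z : 'rV[R]_m, `|z *m A| <= K * `|z|.
Proof.
exists (m%:R * `|A| + 1); first by rewrite ltr_wpDl// mulr_ge0.
move=> z; apply: norm_le_coord => [|i j].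
  by rewrite mulr_ge0// addr_ge0// mulr_ge0.
rewrite mxE (le_trans (ler_norm_sum _ _ _))//.
apply: (@le_trans _ _ (\sum_(k < m) `|A| * `|z|)).
  apply: ler_sum => k _; rewrite normrM mulrC.
  by apply: ler_pM; rewrite ?coord_norm_le.
rewrite sumr_const card_ord -[leLHS]mulr_natl mulrA ler_wpM2r//.
by rewrite lerDl.
Qed.

Definition chart_point (R : realType) (Q : 'M[R]_3) (h : 'rV[R]_2) (t : R) :
    'rV[R]_3 :=
  (row_mx h (t%:M : 'rV[R]_1) : 'rV[R]_(2 + 1)) *m Q^T.

(** Lets the block lemmas, stated for the width 2 + 1, apply to the last of
    three coordinates. *)
Lemma ord_max_rshift : ord_max = rshift 2 ord0 :> 'I_3.
Proof. exact: val_inj. Qed.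

Lemma horizontalD (R : realType) (Q : 'M[R]_3) (x y : 'rV[R]_3) :
  horizontal Q (x + y) = horizontal Q x + horizontal Q y.
Proof. by rewrite /horizontal mulmxDl linearD. Qed.

Lemma horizontalZ (R : realType) (Q : 'M[R]_3) (t : R) (x : 'rV[R]_3) :
  horizontal Q (t *: x) = t *: horizontal Q x.
Proof. by rewrite /horizontal -scalemxAl linearZ. Qed.

Lemma horizontalB (R : realType) (Q : 'M[R]_3) (x y : 'rV[R]_3) :
  horizontal Q (x - y) = horizontal Q x - horizontal Q y.
Proof. by rewrite /horizontal mulmxBl linearB. Qed.

Lemma verticalD (R : realType) (Q : 'M[R]_3) (x y : 'rV[R]_3) :
  vertical Q (x + y) = vertical Q x + vertical Q y.
Proof. by rewrite /vertical mulmxDl mxE. Qed.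

Lemma verticalZ (R : realType) (Q : 'M[R]_3) (t : R) (x : 'rV[R]_3) :
  vertical Q (t *: x) = t * vertical Q x.
Proof. by rewrite /vertical -scalemxAl mxE. Qed.

Lemma horizontal_chart_point (R : realType) (Q : 'M[R]_3) h t :
  Q *m Q^T = 1%:M -> horizontal Q (chart_point Q h t) = h.
Proof.
move=> /mulmx1C QQ.
by rewrite /horizontal /chart_point -mulmxA QQ mulmx1 row_mxKl.
Qed.

Lemma vertical_chart_point (R : realType) (Q : 'M[R]_3) h t :
  Q *m Q^T = 1%:M -> vertical Q (chart_point Q h t) = t.
Proof.
move=> /mulmx1C QQ.
rewrite /vertical /chart_point -mulmxA QQ mulmx1 ord_max_rshift.
transitivity ((t%:M : 'rV[R]_1) 0 ord0); first exact: row_mxEr.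
by rewrite mxE eqxx mulr1n.
Qed.

Lemma chart_pointK (R : realType) (Q : 'M[R]_3) z :
  Q *m Q^T = 1%:M -> chart_point Q (horizontal Q z) (vertical Q z) = z.
Proof.
move=> QQ; rewrite /chart_point /horizontal /vertical ord_max_rshift.
rewrite [X in row_mx _ X](_ : _ = rsubmx (z *m Q : 'rV[R]_(2 + 1))).
  by rewrite hsubmxK -mulmxA QQ mulmx1.
by apply/rowP => i; rewrite !mxE !ord1 eqxx mulr1n.
Qed.

Lemma chart_pointB (R : realType) (Q : 'M[R]_3) h t h' t' :
  chart_point Q h t - chart_point Q h' t' = chart_point Q (h - h') (t - t').
Proof. by rewrite /chart_point -mulmxBl opp_row_mx add_row_mx raddfB. Qed.

(** The coordinates of a chart are compared with the sup norm, which an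
    orthogonal matrix does not preserve; a common constant is all that the
    estimates below need. *)
Lemma chart_bounds (R : realType) (Q : 'M[R]_3) :
  exists2 K : R, 0 < K & forall z h t,
    [/\ `|horizontal Q z| <= K * `|z|, `|vertical Q z| <= K * `|z|
      & `|chart_point Q h t| <= K * (`|h| + `|t|)].
Proof.
have [K1 K10 HK1] := norm_mulmx_le Q.
have [K2 K20 HK2] := norm_mulmx_le Q^T.
exists (K1 + K2); first exact: addr_gt0.
have le1 (z : 'rV[R]_3) : K1 * `|z| <= (K1 + K2) * `|z|.
  by rewrite ler_wpM2r// lerDl ltW.
move=> z h t; split.
- apply: le_trans (le1 z); apply: le_trans (HK1 z).
  apply: norm_le_coord => // i j; rewrite mxE; exact: coord_norm_le.
- by apply: le_trans (le1 z); apply: le_trans (HK1 z); exact: coord_norm_le.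
- apply: le_trans (HK2 _) _; apply: ler_pM; [exact: ltW|by []|lra|].
  apply: norm_le_coord => [|i j]; first by rewrite addr_ge0.
  rewrite mxE; case: splitP => k _.
    by rewrite (le_trans (coord_norm_le _ _ _))// lerDl.
  by rewrite mxE !ord1 eqxx mulr1n lerDr.
Qed.

Lemma lipschitz_bound (R : realType) (V W : normedModType R) (g : V -> W) :
  lipschitz g -> exists2 L : R, 0 < L & forall x y, `|g x - g y| <= L * `|x - y|.
Proof.
move=> /pinfty_ex_gt0[L L0 HL]; exists L => // x y; exact: (HL (x, y)).
Qed.

(** * The boundary as a graph *)

Lemma near_norm_lt (R : realType) (V : normedModType R) (p : V) (P : V -> Prop) :
  (\forall z \near p, P z) <->
  (exists2 r : R, 0 < r & forall z, `|z - p| < r -> P z).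
Proof.
split=> [/nbhs_normP[r /= r0 rP]|[r r0 rP]].
  by exists r => // z zp; apply: rP => /=; rewrite distrC.
by apply/nbhs_normP; exists r => //= z /= zp; apply: rP; rewrite distrC.
Qed.

Lemma frontier_closed (R : realType) (Omega : set 'rV[R]_3) x :
  closed Omega -> frontier Omega x <-> Omega x /\ ~ interior Omega x.
Proof.
by move=> /closure_id cO; rewrite /frontier -cO.
Qed.

(** Below the graph the chart inequality is strict, hence persists nearby; at a
    point of the graph it fails as soon as one moves upwards. *)
Lemma chart_frontier (R : realType) (Omega : set 'rV[R]_3) p Q g :
  closed Omega -> lipschitz_chart Omega p Q g ->
  \forall z \near p, frontier Omega z <-> vertical Q z = g (horizontal Q z).
Proof.
move=> cO [QQ /lipschitz_bound[L L0 gL] /near_norm_lt[r r0 sub]].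
have [K K0 HK] := chart_bounds Q.
apply/near_norm_lt; exists (r / 2); first by rewrite divr_gt0.
move=> z zp.
have subz w : `|w - z| < r / 2 -> Omega w <-> vertical Q w <= g (horizontal Q w).
  move=> wz; apply: sub; rewrite -(subrKA z) (le_lt_trans (ler_normD _ _))//.
  by rewrite (splitr r) ltrD.
have Oz := subz z; rewrite subrr normr0 in Oz.
have {}Oz := Oz (divr_gt0 r0 (ltr0Sn _ _)).
rewrite frontier_closed//; split=> [[/Oz zle nint]|zE].
  apply/eqP; rewrite eq_le zle leNgt/=; apply/negP => zlt; apply: nint.
  (* A displacement w lowers the gap d by at most (K + L K) |w|. *)
  pose d := g (horizontal Q z) - vertical Q z.
  have d0 : 0 < d by rewrite subr_gt0.
  have C0 : 0 < K + L * K by rewrite addr_gt0// mulr_gt0.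
  apply/(near_norm_lt z Omega); exists (Num.min (r / 2) (d / (K + L * K))).
    by rewrite lt_min !divr_gt0.
  move=> w; rewrite lt_min => /andP[wz]; rewrite ltr_pdivlMr// => wd.
  apply/(subz _ wz).
  have [h1 h2 _] := HK (w - z) 0 0.
  have := gL (horizontal Q w) (horizontal Q z).
  rewrite -horizontalB => h3.
  have h4 := ler_wpM2l (ltW L0) h1.
  have := ler_norm (g (horizontal Q z) - g (horizontal Q w)); rewrite distrC.
  have := ler_norm (vertical Q (w - z)).
  have -> : vertical Q w = vertical Q z + vertical Q (w - z).
    by rewrite -verticalD subrKC.
  rewrite /d in wd d0; lra.
split; first by apply/Oz; rewrite zE.
move=> /(near_norm_lt z Omega)[e e0 inO].
(* A vertical displacement by s moves a point by at most K s, which is half of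
   the minimum. *)
pose s := Num.min e (r / 2) / (2 * K).
have m0 : 0 < Num.min e (r / 2) by rewrite lt_min e0 divr_gt0.
have s0 : 0 < s by rewrite /s divr_gt0// mulr_gt0.
have ws : `|z + chart_point Q 0 s - z| < Num.min e (r / 2).
  rewrite addrC addKr; have [_ _ h] := HK 0 0 s.
  rewrite (le_lt_trans h)// normr0 add0r gtr0_norm// /s.
  have -> : K * (Num.min e (r / 2) / (2 * K)) = Num.min e (r / 2) / 2.
    by field; rewrite gt_eqF.
  by rewrite ltr_pdivrMr// ltr_pMr// ltr1n.
move: ws; rewrite lt_min => /andP[/inO Ow wz].
move: Ow => /(subz _ wz).
rewrite verticalD horizontalD horizontal_chart_point// vertical_chart_point//.
by rewrite addr0 zE; lra.
Qed.

(** The line x + t v stays at distance o(t) from the boundary. *)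
Definition tangent_direction (R : realType) (Omega : set 'rV[R]_3)
    (v x : 'rV[R]_3) : Prop :=
  forall e : R, 0 < e -> \forall t \near (0 : R),
    exists w, frontier Omega (x + t *: v + w) /\ `|w| <= e * `|t|.

Lemma near_scale (R : realType) (c r : R) :
  0 < r -> \forall t \near (0 : R), `|t| * c < r.
Proof.
move=> r0; apply/near_norm_lt; exists (r / (`|c| + 1)).
  by rewrite divr_gt0// ltr_wpDl.
move=> t; rewrite subr0 ltr_pdivlMr ?ltr_wpDl//; apply: le_lt_trans.
by rewrite ler_wpM2l// (le_trans (ler_norm c))// lerDl.
Qed.

Lemma mul_row_mx_tr (R : realType) (m n : nat) (x y : 'rV[R]_m) (z w : 'rV[R]_n) :
  row_mx x z *m (row_mx y w)^T = x *m y^T + z *m w^T.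
Proof. by rewrite tr_row_mx mul_row_col. Qed.

(** In chart coordinates the normal is a multiple of (- grad g, 1), and v is
    (a, b): orthogonality reads - grad g . a + b = 0. *)
Lemma graph_normal_orthogonal (R : realType) (g : 'rV[R]_2 -> R^o) (y : 'rV[R]_2)
    (Q : 'M[R]_3) (v : 'rV[R]_3) :
  differentiable g y -> v *m (graph_normal g y *m Q^T)^T = 0 ->
  'D_(horizontal Q v) g y = vertical Q v.
Proof.
move=> dg; rewrite trmx_mul trmxK mulmxA /graph_normal.
set c := _^-1; rewrite linearZ /= -scalemxAr => /eqP; rewrite scaler_eq0.
have c0 : c != 0.
  rewrite invr_eq0 gt_eqF// sqrtr_gt0 ltr_wpDr// sumr_ge0// => i _.
  exact: sqr_ge0.
rewrite (negbTE c0) /=; set z : 'rV[R]_(2 + 1) := v *m Q.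
rewrite -(hsubmxK z) => /eqP H0.
have := mul_row_mx_tr (lsubmx z) (- gradient g y) (rsubmx z) 1%:M.
move=> /esym E; have := etrans E H0 => {E}.
move=> /matrixP/(_ 0 0).
rewrite trmx1 mulmx1 linearN mulmxN mxE [X in X + _]mxE [RHS]mxE => /eqP.
rewrite addrC subr_eq0 => /eqP H.
have -> : vertical Q v = rsubmx z 0 0 by rewrite mxE /vertical ord_max_rshift.
rewrite H mxE deriveE// (row_sum_delta (horizontal Q v)) linear_sum /=.
apply: eq_bigr => i _; rewrite linearZ /= /horizontal -/z !mxE deriveE//.
Qed.

Lemma derive_near (R : realType) (V : normedModType R) (g : V -> R^o) (y a : V)
    (e : R) :
  derivable g y a -> 0 < e ->
  \forall t \near (0 : R), `|g (y + t *: a) - g y - t * 'D_a g y| <= e * `|t|.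
Proof.
move=> /derivable_nbhs/eqaddoP/(_ e) + e0 => /(_ e0).
apply: filterS => t; rewrite /= => H.
by rewrite -addrA -opprD (addrC y).
Qed.

(** * Tangent directions *)

(** Correct x + t v vertically, in the chart that defines n, by the amount
    g (h + t a) - g h - t b.  It lands on the graph, and the correction is o(t)
    because b is the derivative of g in the direction a. *)
Lemma orthogonal_normal_tangent (R : realType) (Omega : set 'rV[R]_3)
    (x n v : 'rV[R]_3) :
  closed Omega -> outward_unit_normal Omega x n -> v *m n^T = 0 ->
  tangent_direction Omega v x.
Proof.
move=> cO [fx [Q [g [ch dg nE]]]] vn e e0.
have QQ : Q *m Q^T = 1%:M by case: ch.
have [K K0 HK] := chart_bounds Q.
pose a := horizontal Q v; pose b := vertical Q v.
have ab : 'D_a g (horizontal Q x) = b.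
  by apply: graph_normal_orthogonal; rewrite // -nE.
have /near_norm_lt[r r0 graph] := chart_frontier cO ch.
have vx : vertical Q x = g (horizontal Q x).
  by apply/graph; rewrite ?subrr ?normr0.
have dga : derivable g (horizontal Q x) a by exact: diff_derivable.
have := derive_near dga (divr_gt0 e0 K0).
rewrite ab => near_t.
apply: filterS2 (near_scale (`|v| + e) r0) near_t => t tr Ht.
pose s := g (horizontal Q x + t *: a) - g (horizontal Q x) - t * b.
have wt : `|chart_point Q 0 s| <= e * `|t|.
  have [_ _ /le_trans] := HK 0 0 s; apply; rewrite normr0 add0r.
  rewrite -ler_pdivlMl//; apply: le_trans Ht _.
  by rewrite mulrA [K^-1 * e]mulrC.
exists (chart_point Q 0 s); split => //; apply/graph.
  rewrite -(addrA x) addrAC subrr add0r (le_lt_trans (ler_normD _ _))//.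
  by rewrite normrZ (le_lt_trans _ tr)// mulrDr lerD2l mulrC.
rewrite !verticalD !horizontalD horizontal_chart_point// vertical_chart_point//.
by rewrite horizontalZ verticalZ addr0 vx /s -/a -/b; ring.
Qed.

(** Conversely, in a fixed chart: x + t v + w lies on the graph for some
    w = o(t), and removing w changes both sides of the equation of the graph by
    O(w), since g is Lipschitz. *)
Lemma tangent_flat (R : realType) (Omega : set 'rV[R]_3) (p v : 'rV[R]_3) Q g :
  closed Omega -> lipschitz_chart Omega p Q g ->
  \forall z \near p, frontier Omega z -> tangent_direction Omega v z ->
    flat (fun t => g (horizontal Q z + t *: horizontal Q v) - t * vertical Q v) 0.
Proof.
move=> cO ch; have [QQ /lipschitz_bound[L L0 gL] _] := ch.
have [K K0 HK] := chart_bounds Q.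
have /near_norm_lt[r r0 graph] := chart_frontier cO ch.
apply/near_norm_lt; exists (r / 2); first by rewrite divr_gt0.
move=> z zp fz tz e e0; have r20 : 0 < r / 2 by rewrite divr_gt0.
have vz : vertical Q z = g (horizontal Q z).
  by apply/graph => //; rewrite (lt_le_trans zp)// ler_pdivrMr// ler_pMr// ler1n.
have C0 : 0 < K + L * K by rewrite addr_gt0// mulr_gt0.
apply: filterS2 (near_scale (`|v| + e / (K + L * K)) r20)
  (tz _ (divr_gt0 e0 C0)) => t tr [w [fw wt]].
have near_w : `|z + t *: v + w - p| < r.
  rewrite (_ : _ - p = (z - p) + (t *: v + w)); last first.
    by rewrite -(addrA z) addrAC.
  rewrite (le_lt_trans (ler_normD _ _))// (splitr r) ltrD//.
  rewrite (le_lt_trans (ler_normD _ _))// normrZ (le_lt_trans _ tr)//.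
  by rewrite mulrDr lerD2l mulrC.
move/(graph _ near_w): fw.
rewrite !verticalD !horizontalD verticalZ horizontalZ vz => gw.
have [h1 h2 _] := HK w 0 0.
set h := horizontal Q z in gw *; set a := horizontal Q v in gw *.
have := gL (h + t *: a) (h + t *: a + horizontal Q w).
rewrite opprD addrA subrr sub0r normrN -gw => h3.
rewrite add0r scale0r addr0 mul0r subr0.
have -> : g (h + t *: a) - t * vertical Q v - g h =
  (g (h + t *: a) - (g h + t * vertical Q v + vertical Q w)) + vertical Q w.
  by ring.
rewrite (le_trans (ler_normD _ _))//.
have h4 := ler_wpM2l (ltW L0) h1.
have : (K + L * K) * `|w| <= e * `|t|.
  by rewrite -ler_pdivlMl// mulrA [_^-1 * e]mulrC.
by lra.
Qed.

Definition plane_basis (R : realType) (d1 d2 : 'rV[R]_2) : Prop :=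
  exists2 K : R, 0 < K & forall s t : R,
    `|s| <= K * `|s *: d1 + t *: d2| /\ `|t| <= K * `|s *: d1 + t *: d2|.

(** The points of the graph that lie in N have a negligible projection, in
    every affine coordinate system of the plane below.  The freedom in the
    coordinates allows one axis to be put along a prescribed direction. *)
Definition graph_null (R : realType) (Q : 'M[R]_3) (g : 'rV[R]_2 -> R^o)
    (N : set 'rV[R]_3) : Prop :=
  forall h d1 d2 : 'rV[R]_2, plane_basis d1 d2 ->
  (@lebesgue_measure R \x @lebesgue_measure R)%E.-negligible
    [set p : R * R | let y := h + p.1 *: d1 + p.2 *: d2 in
                     N (chart_point Q y (g y))].

(** Two parameters whose graph points lie in a common ball of radius r differ
    by at most D r in each coordinate, where D depends only on the chart and
    the coordinate system.  So a cover of N by balls gives a cover of the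
    parameters by squares. *)
Lemma surface_null_graph (R : realType) (Q : 'M[R]_3) (g : 'rV[R]_2 -> R^o)
    (N : set 'rV[R]_3) :
  Q *m Q^T = 1%:M -> surface_null N -> graph_null Q g N.
Proof.
move=> QQ null h d1 d2 [C C0 HC]; apply: square_cover_negligible => e e0.
have [K K0 HK] := chart_bounds Q.
pose D := C * (K * 2); have D0 : 0 < D by rewrite !mulr_gt0.
have [c [r [Nc rsum]]] := null _ (divr_gt0 e0 (exprn_gt0 2 D0)).
pose y (p : R * R) := h + p.1 *: d1 + p.2 *: d2.
pose z (p : R * R) := chart_point Q (y p) (g (y p)).
have diam k p q : ball (c k) (r k) (z p) -> ball (c k) (r k) (z q) ->
    `|p.1 - q.1| <= D * r k /\ `|p.2 - q.2| <= D * r k.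
  rewrite -ball_normE /= => zp zq.
  have zpq : `|z p - z q| <= 2 * r k.
    rewrite -(subrKA (c k)) (le_trans (ler_normD _ _))// mulr_natl mulr2n.
    by rewrite lerD// ltW// distrC.
  have ypq : `|y p - y q| <= K * (2 * r k).
    have [+ _ _] := HK (z p - z q) 0 0.
    rewrite horizontalB !horizontal_chart_point// => /le_trans; apply.
    by rewrite ler_wpM2l// ltW.
  have E : y p - y q = (p.1 - q.1) *: d1 + (p.2 - q.2) *: d2.
    by apply/rowP => i; rewrite /y !mxE; ring.
  have [] := HC (p.1 - q.1) (p.2 - q.2); rewrite -E => h1 h2.
  have h3 : C * `|y p - y q| <= D * r k.
    by rewrite /D -!mulrA ler_wpM2l// ltW.
  by split; [exact: le_trans h1 _|exact: le_trans h2 _].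
have /choice[q Hq] : forall k, exists q : R * R, forall p,
    ball (c k) (r k) (z p) -> `|p.1 - q.1| <= D * r k /\ `|p.2 - q.2| <= D * r k.
  move=> k; have [[q Hq]|nq] := pselect (exists q, ball (c k) (r k) (z q)).
    by exists q => p Hp; exact: diam.
  by exists (0, 0) => p Hp; exfalso; apply: nq; exists p.
exists q, (fun k => D * r k); split.
  by move=> p /= /Nc[k _ zk]; exists k => //; exact: Hq.
under eq_eseriesr do rewrite exprMn EFinM.
rewrite nneseriesZl; last by move=> k _; rewrite lee_fin sqr_ge0.
rewrite (le_trans (lee_wpmul2l _ rsum))//; first by rewrite lee_fin sqr_ge0.
by rewrite -EFinM lee_fin mulrC divfK// gt_eqF// exprn_gt0.
Qed.

Lemma graph_nullU (R : realType) (Q : 'M[R]_3) (g : 'rV[R]_2 -> R^o)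
    (N1 N2 : set 'rV[R]_3) :
  graph_null Q g N1 -> graph_null Q g N2 -> graph_null Q g (N1 `|` N2).
Proof.
move=> H1 H2 h d1 d2 bd.
apply: negligibleS (negligibleU (H1 h d1 d2 bd) (H2 h d1 d2 bd)).
by move=> p /= [|]; [left|right].
Qed.

Lemma negligible_dense_compl (R : realType) (N : set R) (e : R) :
  0 < e -> (@lebesgue_measure R).-negligible N ->
  exists2 s, `|s| < e & ~ N s.
Proof.
move=> e0 nN; apply: contrapT => H.
have sub : `]- e, e[%classic `<=` N.
  move=> s; rewrite /= in_itv/= -ltr_norml => se.
  by apply: contrapT => Ns; apply: H; exists s.
have nI : (@lebesgue_measure R).-negligible `]- e, e[%classic.
  exact: negligibleS nN.
have mI : measurable (`]- e, e[%classic : set (measurableTypeR R)).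
  exact: measurable_itv.
have : @lebesgue_measure R `]- e, e[%classic = 0%E.
  exact: measure_negligible nI.
rewrite lebesgue_measure_itv /= lte_fin ifT; last by lra.
by move=> /eqP; rewrite -EFinB eqe; apply/negP; rewrite gt_eqF//; lra.
Qed.

(** * Boundaries tangent to a fixed direction *)

(** The other vector is a rotated by a right angle; the coefficients of a
    vector w are then its inner products with the basis divided by |a|^2. *)
Lemma plane_basis_extend (R : realType) (a : 'rV[R]_2) :
  a != 0 -> exists d, plane_basis d a.
Proof.
move=> a0; pose x := a 0 0; pose y := a 0 1.
have D0 : 0 < x ^+ 2 + y ^+ 2.
  rewrite lt_neqAle addr_ge0 ?sqr_ge0// andbT eq_sym.
  apply: contra a0; rewrite paddr_eq0 ?sqr_ge0// !sqrf_eq0 => /andP[x0 y0].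
  apply/eqP/rowP => i; rewrite [RHS]mxE.
  have [->|->] : i = 0 \/ i = 1.
    by case: i => [[|[|//]] ?]; [left|right]; exact: val_inj.
  - exact/eqP.
  - exact/eqP.
exists (\row_j if j == 0 then - y else x).
exists ((`|x| + `|y|) / (x ^+ 2 + y ^+ 2) + 1).
  by rewrite ltr_wpDl// mulr_ge0 ?addr_ge0// invr_ge0 ltW.
move=> s t; set w : 'rV[R]_2 := _ *: _ + _.
have w0 : w 0 0 = - (s * y) + t * x by rewrite !mxE eqxx -/x; ring.
have w1 : w 0 1 = s * x + t * y by rewrite !mxE.
suff H r : `|r * (x ^+ 2 + y ^+ 2)| <= (`|x| + `|y|) * `|w| ->
    `|r| <= ((`|x| + `|y|) / (x ^+ 2 + y ^+ 2) + 1) * `|w|.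
  split; apply: H.
  - rewrite (_ : _ * _ = x * w 0 1 - y * w 0 0); last by rewrite w0 w1; ring.
    rewrite (le_trans (ler_normB _ _))// mulrDl !normrM.
    by rewrite lerD// ler_wpM2l// coord_norm_le.
  - rewrite (_ : _ * _ = x * w 0 0 + y * w 0 1); last by rewrite w0 w1; ring.
    rewrite (le_trans (ler_normD _ _))// mulrDl !normrM.
    by rewrite lerD// ler_wpM2l// coord_norm_le.
rewrite normrM (gtr0_norm D0) -ler_pdivlMr// => /le_trans; apply.
by rewrite mulrAC [leRHS]mulrDl lerDl mul1r.
Qed.

(** Let (a, b) be the coordinates of v in the chart.  On almost every line
    parallel to a, the Lipschitz function t |-> g (h + t a) - t b is flat almost
    everywhere, hence constant; such lines accumulate at the one below p, where
    the function is constant too by continuity.  If a = 0, then v is vertical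
    and flatness at one point already contradicts b <> 0. *)
Lemma frontier_contains_segment (R : realType) (Omega : set 'rV[R]_3)
    (p v : 'rV[R]_3) Q g (N : set 'rV[R]_3) :
  closed Omega -> frontier Omega p -> lipschitz_chart Omega p Q g -> v != 0 ->
  graph_null Q g N ->
  (\forall z \near p, frontier Omega z -> ~ N z -> tangent_direction Omega v z) ->
  \forall t \near (0 : R), frontier Omega (p + t *: v).
Proof.
move=> cO fp ch v0 nullN tangN.
have [QQ /lipschitz_bound[L L0 gL] _] := ch.
have [K K0 HK] := chart_bounds Q.
have chf := chart_frontier cO ch.
have /near_norm_lt[r1 r10 graph] := chf.
have /near_norm_lt[r2 r20 tang] := tangN.
have /near_norm_lt[r3 r30 flatz] := tangent_flat v cO ch.
pose a := horizontal Q v; pose b := vertical Q v.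
pose h0 := horizontal Q p.
pose z h := chart_point Q h (g h).
have vp : vertical Q p = g h0 by apply/graph; rewrite ?subrr ?normr0.
have zh0 : z h0 = p by rewrite /z -vp chart_pointK.
pose r := Num.min r1 (Num.min r2 r3).
have r0 : 0 < r by rewrite !lt_min r10 r20 r30.
have C0 : 0 < K * (1 + L) by rewrite mulr_gt0// addr_gt0.
pose d := r / (K * (1 + L)).
have d0 : 0 < d by rewrite divr_gt0.
have zp h : `|h - h0| < d -> `|z h - p| < r.
  rewrite ltr_pdivlMr// => hd; apply: le_lt_trans hd.
  rewrite -zh0 chart_pointB; have [_ _ /le_trans] := HK 0 (h - h0) (g h - g h0).
  apply; rewrite [leRHS]mulrCA ler_wpM2l ?(ltW K0)// mulrDr mulr1 lerD2l mulrC.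
  exact: gL.
have good h : `|h - h0| < d -> ~ N (z h) ->
    flat (fun t => g (h + t *: a) - t * b) 0.
  move=> /zp; rewrite !lt_min => /and3P[zr1 zr2 zr3] Nz.
  have fz : frontier Omega (z h).
    apply/graph => //.
    by rewrite /z horizontal_chart_point// vertical_chart_point.
  have := flatz _ zr3 fz (tang _ zr2 fz Nz).
  by rewrite /z horizontal_chart_point.
(* When a = 0 any coordinate system will do. *)
have [d2 [d2E [d1 bd]]] : exists d2, (a != 0 -> d2 = a) /\
    exists d1, plane_basis d1 d2.
  have [a0|a0] := eqVneq a 0; last first.
    by exists a; split => //; exact: plane_basis_extend.
  exists (const_mx 1); split; first by [].
  apply: plane_basis_extend; apply/eqP => /rowP /(_ 0).
  by rewrite !mxE => /eqP; rewrite oner_eq0.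
pose y s t := h0 + s *: d1 + t *: d2.
pose D := `|d1| + `|d2| + 1.
have D0 : 0 < D by rewrite ltr_wpDl// addr_ge0.
pose eta := d / D.
have eta0 : 0 < eta by rewrite divr_gt0.
have yd s t : `|s| < eta -> `|t| <= eta -> `|y s t - h0| < d.
  move=> se te; rewrite /y -(addrA h0) addrAC subrr add0r.
  rewrite (le_lt_trans (ler_normD _ _))// !normrZ.
  apply: (@le_lt_trans _ _ (eta * `|d1| + eta * `|d2|)).
    by rewrite lerD// ler_wpM2r// ltW.
  rewrite -mulrDr /eta -mulrA [D^-1 * _]mulrC mulrA ltr_pdivrMr//.
  by rewrite ltr_pM2l// ltrDl.
have nullsec := negligible_xsections (nullN h0 d1 d2 bd).
have [a0|a0] := eqVneq a 0.
  exfalso.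
  have b0 : b != 0.
    apply: contra_neq v0 => b0; rewrite -(chart_pointK v QQ) -/a -/b a0 b0.
    by rewrite /chart_point raddf0 row_mx0 mul0mx.
  have [s se /contrapT nsec] := negligible_dense_compl eta0 nullsec.
  have [t te Nst] := negligible_dense_compl eta0 nsec.
  have := good _ (yd s t se (ltW te)) Nst.
  have b20 : 0 < `|b| / 2 by rewrite divr_gt0// normr_gt0.
  move=> /(_ _ b20) /near_norm_lt[e e0 He].
  have [q q0 qe] : exists2 q, 0 < q & `|q| < e.
    exists (e / 2); first by rewrite divr_gt0.
    by rewrite gtr0_norm ?divr_gt0// ltr_pdivrMr// ltr_pMr// ltr1n.
  have := He q; rewrite subr0 a0 !scaler0 mul0r add0r subr0 addrAC subrr.
  rewrite sub0r normrN normrM => /(_ qe).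
  rewrite mulrC ler_pM2r ?normr_gt0 ?gt_eqF// leNgt ltr_pdivrMr//.
  by rewrite ltr_pMr ?normr_gt0// ltr1n.
have {}d2E := d2E a0.
pose u s t := g (y s t) - t * b.
have ulip s t t' : `|u s t - u s t'| <= (L * `|a| + `|b|) * `|t - t'|.
  have -> : u s t - u s t' = (g (y s t) - g (y s t')) - (t - t') * b.
    by rewrite /u; ring.
  rewrite (le_trans (ler_normB _ _))// normrM mulrDl [`|b| * _]mulrC lerD2r.
  rewrite (le_trans (gL _ _))// -mulrA ler_wpM2l ?(ltW L0)//.
  by rewrite /y opprD addrACA subrr add0r -scalerBl normrZ d2E mulrC.
have ucst s t : `|s| < eta -> ~ ~ (@lebesgue_measure R).-negligible
    [set t | N (z (y s t))] -> `|t| <= eta -> u s t = u s (- eta).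
  move=> se /contrapT nsec; rewrite ler_norml => /andP[te1 te2].
  apply: (lipschitz_ae_flat_cst _ (ulip s) te1 nsec).
    by rewrite addr_ge0// mulr_ge0// ltW.
  move=> t' /andP[t'1 t'2] Nt'.
  have t'e : `|t'| <= eta by rewrite ler_norml t'1 ltW// (lt_le_trans t'2).
  move=> e e0; have := good _ (yd s t' se t'e) Nt' e e0.
  apply: filterS => q; rewrite add0r scale0r mul0r addr0 subr0.
  rewrite (_ : u s (t' + q) - u s t' = g (y s t' + q *: a) - q * b - g (y s t'))//.
  by rewrite /u /y scalerDl d2E addrA; ring.
have u0 t : `|t| <= eta -> u 0 t = u 0 (- eta).
  move=> te; apply/eqP; rewrite -subr_eq0 -normr_le0; apply/ler_addgt0Pr => e e0.
  rewrite add0r.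
  have C1 : 0 < 2 * L * (`|d1| + 1) by rewrite !mulr_gt0// ltr_wpDl.
  have m0 : 0 < Num.min eta (e / (2 * L * (`|d1| + 1))).
    by rewrite lt_min eta0 divr_gt0.
  have [s] := negligible_dense_compl m0 nullsec.
  rewrite lt_min => /andP[se]; rewrite ltr_pdivlMr// => se2 nsec.
  have close t' : `|u 0 t' - u s t'| <= L * (`|s| * `|d1|).
    rewrite (_ : u 0 t' - u s t' = g (y 0 t') - g (y s t')); last first.
      by rewrite /u; ring.
    rewrite (le_trans (gL _ _))// ler_wpM2l ?(ltW L0)//.
    rewrite /y scale0r addr0 opprD addrACA subrr addr0 opprD addNKr.
    by rewrite normrN normrZ.
  (* Compare the line s = 0 with the good line s, at t and at - eta. *)
  have e1 := close t; have := close (- eta); rewrite distrC => e2.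
  have -> : u 0 t - u 0 (- eta) =
      (u 0 t - u s t) + (u s (- eta) - u 0 (- eta)).
    by rewrite (ucst s t se nsec te); ring.
  rewrite (le_trans (ler_normD _ _))//.
  have : 0 <= L * `|s| by rewrite mulr_ge0// ltW.
  by lra.
have line t : `|t| <= eta -> g (h0 + t *: a) = g h0 + t * b.
  move=> te; have e1 := u0 t te.
  have := u0 0; rewrite normr0 => /(_ (ltW eta0)); rewrite -e1 /u /y.
  rewrite !scale0r !addr0 d2E mul0r subr0 => ->; ring.
have C2 : 0 < `|v| + 1 by rewrite ltr_wpDl.
apply/near_norm_lt; exists (Num.min eta (r1 / (`|v| + 1))).
  by rewrite lt_min eta0 divr_gt0.
move=> t; rewrite subr0 lt_min => /andP[te]; rewrite ltr_pdivlMr// => tr.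
apply/graph.
  rewrite addrC addKr normrZ; apply: le_lt_trans tr.
  by rewrite ler_wpM2l// lerDl.
by rewrite verticalD horizontalD verticalZ horizontalZ vp line// ltW.
Qed.

(** * Transport along lines up to the boundary *)

Lemma within_continuous_norm (R : realType) (Omega : set 'rV[R]_3)
    (f : 'rV[R]_3 -> R^o) p e :
  {within Omega, continuous f} -> Omega p -> 0 < e ->
  exists2 r : R, 0 < r & forall y, Omega y -> `|y - p| < r -> `|f y - f p| < e.
Proof.
move=> /subspace_continuousP/(_ p) + Op e0 => /(_ Op)/cvgrPdist_lt/(_ e e0).
rewrite /prop_near1 /within /= => /near_norm_lt[r r0 H].
by exists r => // y Oy /H /(_ Oy); rewrite distrC.
Qed.

Lemma derive0_segment_cst (R : realType) (V : normedModType R) (f : V -> R^o)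
    (x v : V) (t : R) :
  0 <= t -> (forall s, 0 <= s <= t -> is_derive (x + s *: v) v f 0) ->
  f (x + t *: v) = f x.
Proof.
rewrite le_eqVlt => /predU1P[<- _|t0 df]; first by rewrite scale0r addr0.
pose phi (s : R) : R^o := f (x + s *: v).
have dphi s : 0 <= s <= t -> is_derive s (1 : R) phi 0.
  move=> /df [dfs Dfs].
  have E : (fun h : R => h^-1 *: ((phi \o shift s) (h *: 1) - phi s)) =
           (fun h : R => h^-1 *: ((f \o shift (x + s *: v)) (h *: v) -
                                  f (x + s *: v))).
    apply/funext => h; rewrite /phi /= scalerDl.
    by rewrite addrCA [h *: 1]mulr1.
  by split; rewrite /derivable /derive E.
have cphi : {within `[0, t], continuous phi}.
  apply: derivable_within_continuous => s; rewrite in_itv/= => /dphi.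
  by case.
have [|c _] := @MVT R phi (cst 0) 0 t t0 _ cphi.
  move=> s; rewrite in_itv/= => /andP[s0 st].
  by apply: dphi; rewrite !ltW.
by rewrite mul0r /phi scale0r addr0 => /eqP; rewrite subr_eq0 => /eqP.
Qed.

(** tau is the supremum of the lengths of the segments issued from x in the
    direction v that stay in the interior. *)
Lemma exit_point (R : realType) (Omega : set 'rV[R]_3) (v x : 'rV[R]_3) :
  closed Omega -> bounded_set Omega -> v != 0 -> interior Omega x ->
  exists tau : R, [/\ 0 < tau, frontier Omega (x + tau *: v)
    & forall t, 0 <= t < tau -> interior Omega (x + t *: v)].
Proof.
move=> cO /pinfty_ex_gt0[M M0 OM] v0 ix.
pose S := [set t : R | 0 <= t /\
  forall s, 0 <= s <= t -> interior Omega (x + s *: v)].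
have S0 : S 0.
  split=> // s; rewrite -eq_le => /eqP <-; by rewrite scale0r addr0.
have nv0 : 0 < `|v| by rewrite normr_gt0.
have supS : has_sup S.
  split; first by exists 0.
  exists ((M + `|x|) / `|v|) => t [t0 /(_ t)]; rewrite t0 lexx => /(_ isT).
  move=> /interior_subset /OM; rewrite ler_pdivlMr// => H.
  have : `|t *: v| <= `|x + t *: v| + `|x|.
    by rewrite -{1}(addKr x (t *: v)) addrC (le_trans (ler_normB _ _)).
  by rewrite normrZ ger0_norm//; move/le_trans; apply; rewrite lerD2r.
pose tau := sup S.
have near_extend s : interior Omega (x + s *: v) -> exists2 d, 0 < d &
    forall q, `|q - s| < d -> interior Omega (x + q *: v).
  have := open_interior Omega.
  rewrite openE => /[apply] /(near_norm_lt _ (interior Omega))[r r0 H].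
  exists (r / `|v|); first by rewrite divr_gt0.
  move=> q; rewrite ltr_pdivlMr// => qs; apply: H.
  by rewrite opprD addrACA subrr add0r -scalerBl normrZ.
have inS t : 0 <= t < tau -> interior Omega (x + t *: v).
  move=> /andP[t0 /(sup_gt (ex_intro _ _ S0))[s [s0 Ss] ts]].
  by apply: Ss; rewrite t0 ltW.
have tau_ge t : S t -> t <= tau by move=> St; apply: ub_le_sup => //; case: supS.
have extend s : 0 <= s -> (forall q, 0 <= q < s -> interior Omega (x + q *: v)) ->
    interior Omega (x + s *: v) -> s < tau.
  move=> s0 before /near_extend[d d0 Hd].
  apply: (@lt_le_trans _ _ (s + d / 2)); first by rewrite ltrDl divr_gt0.
  apply: tau_ge; split; first by rewrite addr_ge0// divr_ge0// ltW.
  move=> q /andP[q0 qd]; have [qs|sq] := ltP q s; first by apply: before; rewrite q0.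
  by apply: Hd; rewrite ger0_norm ?subr_ge0//; lra.
have tau0 : 0 < tau.
  apply: extend => //; last by rewrite scale0r addr0.
  by move=> q /andP[q0]; rewrite ltNge q0.
exists tau; split => //; apply/frontier_closed => //; split.
  apply: cO => B /near_norm_lt[r r0 HB].
  pose t := Num.max 0 (tau - r / (2 * `|v|)).
  have rv : 0 < r / (2 * `|v|) by rewrite divr_gt0// mulr_gt0.
  have tt : t < tau by rewrite gt_max tau0 gtrBl.
  exists (x + t *: v); split.
    by apply: interior_subset; apply: (inS t); rewrite tt le_max lexx.
  apply: HB; rewrite opprD addrACA subrr add0r -scalerBl normrZ distrC.
  rewrite gtr0_norm ?subr_gt0//.
  have h : tau - t <= r / (2 * `|v|) by rewrite lerBlDr -lerBlDl le_max lexx orbT.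
  rewrite (le_lt_trans (ler_wpM2r (ltW nv0) h))//.
  rewrite (_ : r / (2 * `|v|) * `|v| = r / 2); last by field; rewrite gt_eqF.
  by rewrite ltr_pdivrMr// ltr_pMr// ltr1n.
by move=> /(extend _ (ltW tau0) inS); rewrite ltxx.
Qed.

(** At the point p where the line from x leaves the interior f still takes the
    value f x.  If it is nonzero, v is tangent to the boundary almost
    everywhere near p, so the line stays in the boundary on both sides of p,
    whereas it comes from the interior. *)
Lemma transported_component_eq0 (R : realType) (Omega : set 'rV[R]_3)
    (v : 'rV[R]_3) (f : 'rV[R]_3 -> R^o) (N : set 'rV[R]_3) :
  closed Omega -> bounded_set Omega -> lipschitz_boundary Omega -> v != 0 ->
  {within Omega, continuous f} ->
  (forall y, interior Omega y -> is_derive y v f 0) ->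
  (forall Q g, Q *m Q^T = 1%:M -> graph_null Q g N) ->
  (forall z, frontier Omega z -> ~ N z -> f z != 0 ->
    tangent_direction Omega v z) ->
  forall x, interior Omega x -> f x = 0.
Proof.
move=> cO bO lipO v0 cf df nullN tanf x ix.
apply/eqP; apply: contrapT => /negP fx0.
have [tau [tau0 fp inseg]] := exit_point cO bO v0 ix.
set p := x + tau *: v in fp.
have Op : Omega p by have /(frontier_closed _ cO)[] := fp.
have Oseg t : 0 <= t < tau -> Omega (x + t *: v).
  by move=> /inseg; exact: interior_subset.
have fseg t : 0 <= t < tau -> f (x + t *: v) = f x.
  move=> /andP[t0 tt]; apply: derive0_segment_cst => // s /andP[s0 st].
  by apply/df/inseg; rewrite s0 (le_lt_trans st).
have near_tau d : 0 < d -> exists2 t, 0 <= t < tau & `|t - tau| < d.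
  move=> d0; exists (Num.max 0 (tau - d / 2)).
    by rewrite le_max lexx /= gt_max tau0 gtrBl divr_gt0.
  rewrite distrC ger0_norm; last first.
    by rewrite subr_ge0 ge_max (ltW tau0) gerBl divr_ge0// ltW.
  rewrite ltrBlDr -ltrBlDl lt_max; apply/orP; right.
  by rewrite ltrD2l ltrN2 ltr_pdivrMr// ltr_pMr// ltr1n.
have nv0 : 0 < `|v| by rewrite normr_gt0.
have tp t r : `|t - tau| < r / `|v| -> `|x + t *: v - p| < r.
  rewrite ltr_pdivlMr// => tr.
  by rewrite /p opprD addrACA subrr add0r -scalerBl normrZ.
have fpx : f p = f x.
  apply/eqP; rewrite -subr_eq0 -normr_le0; apply/ler_addgt0Pr => e e0.
  rewrite add0r; have [r r0 Hr] := within_continuous_norm cf Op e0.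
  have [t tt td] := near_tau _ (divr_gt0 r0 nv0).
  by rewrite -(fseg t tt) distrC ltW// Hr ?tp//; exact: Oseg.
have [Q [g ch]] := lipO p fp; have [QQ _ _] := ch.
have e0 : 0 < `|f p| by rewrite normr_gt0 fpx.
have [r r0 Hr] := within_continuous_norm cf Op e0.
have tanN : \forall z \near p, frontier Omega z -> ~ N z ->
    tangent_direction Omega v z.
  apply/near_norm_lt; exists r => // z zp fz Nz; apply: tanf => //.
  have /(frontier_closed _ cO)[Oz _] := fz.
  apply/eqP => fz0; have := Hr z Oz zp.
  by rewrite fz0 sub0r normrN ltxx.
have := frontier_contains_segment cO fp ch v0 (nullN Q g QQ) tanN.
move=> /near_norm_lt[d d0 Hd].
have [t tt td] := near_tau _ d0.
have : frontier Omega (p + (t - tau) *: v) by apply: Hd; rewrite subr0.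
rewrite /p -addrA -scalerDl subrKC => /(frontier_closed _ cO)[_].
by apply; exact: inseg.
Qed.

(** * Stress fields *)

Lemma bounded_closure (R : realType) (U : set 'rV[R]_3) :
  bounded_set U -> bounded_set (closure U).
Proof.
move=> /pinfty_ex_gt0[M M0 UM]; exists (M + 1); split; first exact: num_real.
move=> B MB x cx; apply: le_trans (ltW MB).
have [y [Uy xy]] : U `&` [set y | `|y - x| < 1] !=set0.
  by apply: cx; apply/(near_norm_lt x (fun y => `|y - x| < 1)); exists 1.
rewrite -(subrK y x) (le_trans (ler_normD _ _))// addrC lerD//; first exact: UM.
by rewrite distrC ltW.
Qed.

Lemma Ck_derivable (R : realType) (k : nat) (Omega : set 'rV[R]_3)
    (f : 'rV[R]_3 -> R^o) x i :
  Ck_on k.+1 Omega f -> interior Omega x -> derivable f x (basis_vec R i).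
Proof. by move=> [_ /(_ i)[df [_ H]]] /H []. Qed.

Lemma stressE (R : realType) (E nu : R) (eps : 'rV[R]_3 -> 'M[R]_3) i j :
  (fun x => stress E nu eps x i j : R^o) =
  \sum_k \sum_l elasticity_tensor E nu i j k l \*: (fun x => eps x k l : R^o).
Proof.
apply/funext => x; rewrite mxE fct_sumE; apply: eq_bigr => k _.
by rewrite fct_sumE.
Qed.

Lemma derivable_stress (R : realType) (E nu : R) (Omega : set 'rV[R]_3)
    (eps : 'rV[R]_3 -> 'M[R]_3) x i j k :
  C2_sym_tensor_field Omega eps -> interior Omega x ->
  derivable (fun x => stress E nu eps x i j : R^o) x (basis_vec R k).
Proof.
move=> [C2 _] ix; rewrite stressE.
apply: derivable_sum => a; apply: derivable_sum => b; apply: derivableZ.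
exact: Ck_derivable ix.
Qed.

Lemma continuous_stress (R : realType) (E nu : R) (Omega : set 'rV[R]_3)
    (eps : 'rV[R]_3 -> 'M[R]_3) i j :
  C2_sym_tensor_field Omega eps ->
  {within Omega, continuous (fun x => stress E nu eps x i j : R^o)}.
Proof.
move=> [C2 _]; rewrite (_ : (fun _ => _) = (fun x => \sum_k \sum_l
   elasticity_tensor E nu i j k l * eps x k l)); last first.
  by apply/funext => x; rewrite mxE.
apply/subspace_continuousP => x Ox.
apply: cvg_big => [|k _]; first exact: add_continuous.
apply: cvg_big => [|l _]; first exact: add_continuous.
apply: cvgM; first exact: cvg_cst.
have [+ _] := C2 k l => /subspace_continuousP; exact.
Qed.

(** Off the diagonal the trace term of the compliance law disappears. *)
Lemma stress_shear (R : realType) (E nu : R) (eps : 'rV[R]_3 -> 'M[R]_3) x i j :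
  0 < E -> -1 < nu < 1 / 2 -> (eps x)^T = eps x -> i != j ->
  stress E nu eps x i j = E / (1 + nu) * eps x i j.
Proof.
move=> E0 nuE sym ij; have /andP[nu1 _] := nuE.
rewrite (hooke_inverse i j E0 nuE sym) (negbTE ij) mulr0 subr0; field.
by rewrite gt_eqF//= gt_eqF//; lra.
Qed.

Lemma sym_mx3_offdiag (R : realType) (A B : 'M[R]_3) :
  A^T = A -> B^T = B ->
  A (inord 0) (inord 1) = B (inord 0) (inord 1) ->
  A (inord 0) (inord 2) = B (inord 0) (inord 2) ->
  A (inord 1) (inord 2) = B (inord 1) (inord 2) ->
  forall i j, i != j -> A i j = B i j.
Proof.
move=> As Bs h01 h02 h12 i j.
have tr k l : A k l = B k l -> A l k = B l k.
  by move=> h; rewrite -As -Bs !mxE.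
rewrite -[i]inord_val -[j]inord_val.
case: i => [[|[|[|//]]] ?]; case: j => [[|[|[|//]]] ?] /=;
  rewrite ?eqxx// => _; do ?[exact: h01|exact: h02|exact: h12]; exact: tr.
Qed.

(** * Uniqueness of the strain *)

Theorem mainTheorem2 (R : realType) (E nu : R) (Omega : set 'rV[R]_3)
  (n : 'rV[R]_3 -> 'rV[R]_3) (eps eps' : 'rV[R]_3 -> 'M[R]_3) :
  0 < E -> -1 < nu < 1 / 2 ->
  compact_domain Omega -> lipschitz_boundary Omega ->
  outward_normal_field Omega n ->
  C2_sym_tensor_field Omega eps -> C2_sym_tensor_field Omega eps' ->
  divergence_free Omega (stress E nu eps) ->
  divergence_free Omega (stress E nu eps') ->
  traction_free Omega n (stress E nu eps) ->
  traction_free Omega n (stress E nu eps') ->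
  (forall x, Omega x -> eps x (inord 0) (inord 1) = eps' x (inord 0) (inord 1)) ->
  (forall x, Omega x -> eps x (inord 0) (inord 2) = eps' x (inord 0) (inord 2)) ->
  (forall x, Omega x -> eps x (inord 1) (inord 2) = eps' x (inord 1) (inord 2)) ->
  forall x, Omega x -> eps x = eps' x.
Proof.
move=> E0 nuE [U [_ bU _ oU OE]] lipO nO Ceps Ceps' div div' tra tra' h01 h02 h12.
have cO : closed Omega by rewrite OE; exact: closed_closure.
have bO : bounded_set Omega by rewrite OE; exact: bounded_closure.
have UO : U `<=` interior Omega.
  by rewrite -open_subsetE// OE; exact: subset_closure.
have [_ sym] := Ceps; have [_ sym'] := Ceps'.
set sg := stress E nu eps in div tra *; set sg' := stress E nu eps' in div' tra' *.
have shear x i j : Omega x -> i != j -> sg x i j = sg' x i j.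
  move=> Ox ij; rewrite /sg /sg' !stress_shear//; [|exact: sym'|exact: sym].
  congr (_ * _); apply: sym_mx3_offdiag; [exact: sym|exact: sym'|
    exact: h01|exact: h02|exact: h12|exact: ij].
pose f i : 'rV[R]_3 -> R^o := fun x => sg x i i - sg' x i i.
have df i y : interior Omega y -> is_derive y (basis_vec R i) (f i) 0.
  move=> iy.
  have dg k l m : derivable (fun x => sg x k l : R^o) y (basis_vec R m).
    exact: derivable_stress iy.
  have dg' k l m : derivable (fun x => sg' x k l : R^o) y (basis_vec R m).
    exact: derivable_stress iy.
  have shearD k : k != i -> 'D_(basis_vec R k) (fun x => sg x k i : R^o) y =
      'D_(basis_vec R k) (fun x => sg' x k i : R^o) y.
    move=> ki; apply: near_eq_derive.
    by apply: filterS iy => z Oz; exact: shear.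
  split; first exact: derivableB.
  rewrite (deriveB (dg i i i) (dg' i i i)).
  have : \sum_k 'D_(basis_vec R k) (fun x => sg x k i : R^o) y =
         \sum_k 'D_(basis_vec R k) (fun x => sg' x k i : R^o) y.
    have /rowP/(_ i) := div y iy; have /rowP/(_ i) := div' y iy.
    by rewrite !mxE => -> ->.
  rewrite (bigD1 i)//= [in RHS](bigD1 i)//= (eq_bigr _ shearD).
  by move=> /addIr ->; rewrite subrr.
have cf i : {within Omega, continuous (f i)}.
  apply/subspace_continuousP => x Ox; apply: cvgB.
    by have /subspace_continuousP := @continuous_stress _ E nu _ _ i i Ceps; apply.
  by have /subspace_continuousP := @continuous_stress _ E nu _ _ i i Ceps'; apply.
pose bad (P : 'rV[R]_3 -> Prop) := frontier Omega `&` [set x | ~ P x].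
pose N := bad (fun x => outward_unit_normal Omega x (n x)) `|`
  (bad (fun x => sg x *m (n x)^T = 0) `|` bad (fun x => sg' x *m (n x)^T = 0)).
have nullN Q g : Q *m Q^T = 1%:M -> graph_null Q g N.
  by move=> QQ; do 2?[apply: graph_nullU]; apply: surface_null_graph.
have basis0 i : basis_vec R i != 0 :> 'rV[R]_3.
  apply/eqP => /rowP/(_ i); rewrite !mxE !eqxx => /eqP; rewrite oner_eq0//.
have tanf i z : frontier Omega z -> ~ N z -> f i z != 0 ->
    tangent_direction Omega (basis_vec R i) z.
  move=> fz nNz fiz.
  have good P : ~ bad P z -> P z by move=> nb; apply: contrapT => nP; apply: nb.
  have /good nz : ~ bad (fun x => outward_unit_normal Omega x (n x)) z.
    by move=> b; apply: nNz; left.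
  have /good tz : ~ bad (fun x => sg x *m (n x)^T = 0) z.
    by move=> b; apply: nNz; right; left.
  have /good tz' : ~ bad (fun x => sg' x *m (n x)^T = 0) z.
    by move=> b; apply: nNz; right; right.
  apply: orthogonal_normal_tangent nz _ => //.
  have /(frontier_closed _ cO)[Oz _] := fz.
  have : ((sg z - sg' z) *m (n z)^T) i 0 = 0 by rewrite mulmxBl tz tz' subrr mxE.
  have sgB k : (sg z - sg' z) i k = sg z i k - sg' z i k.
    by rewrite mxE [X in _ + X]mxE.
  rewrite mxE (bigD1 i)//= big1 => [|k ki]; last first.
    by rewrite sgB shear ?subrr ?mul0r// eq_sym.
  rewrite addr0 sgB => /eqP; rewrite mulf_eq0 (negbTE fiz) /=.
  move=> /eqP ni; apply/matrixP => a b; rewrite !ord1 -rowE mxE ni mxE//.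
have f0 x i : Omega x -> f i x = 0.
  move=> Ox; apply/eqP; rewrite -normr_le0; apply/ler_addgt0Pr => e e0.
  have [r r0 Hr] := within_continuous_norm (cf i) Ox e0.
  have : closure U x by rewrite -OE.
  move=> /(_ [set y | `|y - x| < r])[|y [Uy yx]].
    by apply/(near_norm_lt x (fun y => `|y - x| < r)); exists r.
  have := Hr y (interior_subset (UO _ Uy)) yx.
  rewrite (transported_component_eq0 cO bO lipO (basis0 i) (cf i) (df i)
    nullN (tanf i) (UO _ Uy)) sub0r normrN add0r.
  exact: ltW.
move=> x Ox.
have sgE : sg x = sg' x.
  apply/matrixP => i j; have [->|ij] := eqVneq i j; last exact: shear.
  by have /eqP := f0 x j Ox; rewrite subr_eq0 => /eqP.
apply/matrixP => i j.
by rewrite (hooke_inverse i j E0 nuE (sym x Ox))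
           (hooke_inverse i j E0 nuE (sym' x Ox)) -/sg -/sg' sgE.
Qed.
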